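(* Let $P$ be a poset that has property R and satisfies $\Sigma(P\times P)=\Sigma P\times\Sigma P$ (that is, the Scott topology on $P\times P$ equals the product of the Scott topologies). Then $\Sigma P$ is sober.
   Context: For a poset $P$: $D\subseteq P$ is directed if it is nonempty and any two elements of $D$ have an upper bound in $D$; for $A\subseteq P$, $\mathord{\uparrow}A=\{x\in P: x\ge a\text{ for some }a\in A\}$. $U\subseteq P$ is Scott open if $U=\mathord{\uparrow}U$ and, for every directed $D\subseteq P$ such that $\bigvee D$ exists, $\bigvee D\in U$ implies $D\cap U\neq\emptyset$. These sets form the Scott topology $\sigma(P)$, and $\Sigma P=(P,\sigma(P))$. $P\times P$ carries the coordinatewise order. $\mathbf{Fin}\,P=\{\mathord{\uparrow}F : F\subseteq P\text{ nonempty finite}\}$. The poset $P$ has property R if for any family $\{\mathord{\uparrow}F_i : i\in I\}\subseteq\mathbf{Fin}\,P$ with $I\neq\emptyset$ and any $U\in\sigma(P)$, $\bigcap_{i\in I}\mathord{\uparrow}F_i\subseteq U$ implies $\bigcap_{i\in I_0}\mathord{\uparrow}F_i\subseteq U$ for some nonempty finite $I_0\subseteq I$. A nonempty subset $A$ of a space is irreducible if $A\subseteq F_1\cup F_2$ with $F_1,F_2$ closed implies $A\subseteq F_1$ or $A\subseteq F_2$. A space is sober if every irreducible closed subset is the closure of a unique point. *)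

(* Defs.v *)
From HB Require Import structures.
From mathcomp Require Import all_boot all_order.
From mathcomp Require Import boolp classical_sets cardinality topology.

Set Implicit Arguments.
Unset Strict Implicit.
Unset Printing Implicit Defensive.

Import Order.TTheory.

Local Open Scope classical_set_scope.

Section Scott.
Context {d : Order.disp_t} {P : porderType d}.
Implicit Types (A D F U : set P).

Definition directed D : Prop :=
  D !=set0 /\
  forall x y, D x -> D y -> exists2 z, D z & (x <= z)%O && (y <= z)%O.

Definition up_closure A : set P := [set x | exists2 a, A a & (a <= x)%O].

Definition scott_open U : Prop :=
  U = up_closure U /\
  forall D s, directed D -> isLub D s -> U s -> D `&` U !=set0.

(* Fin P, the upper sets generated by nonempty finite subsets *)
Definition fin_upsets : set (set P) :=
  [set up_closure F | F in [set F | F !=set0 /\ finite_set F]].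

Lemma up_closure_sub A : A `<=` up_closure A.
Proof. by move=> x Ax; exists x. Qed.

Lemma scott_openT : scott_open setT.
Proof.
split=> [|D s [[x Dx] _] _ _]; last by exists x.
by apply/seteqP; split=> // x _; exists x.
Qed.

Lemma scott_openI U V : scott_open U -> scott_open V -> scott_open (U `&` V).
Proof.
move=> [Uup Usup] [Vup Vsup].
have upU x y : U x -> (x <= y)%O -> U y.
  by move=> Ux xy; rewrite Uup; exists x.
have upV x y : V x -> (x <= y)%O -> V y.
  by move=> Vx xy; rewrite Vup; exists x.
split=> [|D s Ddir Ds [Us Vs]].
  apply/seteqP; split=> [|y [x [Ux Vx] xy]]; first exact: up_closure_sub.
  by split; [exact: upU xy|exact: upV xy].
have [x [Dx Ux]] := Usup _ _ Ddir Ds Us.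
have [y [Dy Vy]] := Vsup _ _ Ddir Ds Vs.
have [z Dz /andP[xz yz]] := Ddir.2 _ _ Dx Dy.
by exists z; split=> //; split; [exact: upU xz|exact: upV yz].
Qed.

Lemma scott_open_bigU (I : Type) (f : I -> set P) :
  (forall i, scott_open (f i)) -> scott_open (\bigcup_i f i).
Proof.
move=> fop; split=> [|D s Ddir Ds [i _ fis]].
  apply/seteqP; split=> [|y [x [i _ fix_] xy]]; first exact: up_closure_sub.
  by exists i => //; rewrite (fop i).1; exists x.
have [x [Dx fix_]] := (fop i).2 _ _ Ddir Ds fis.
by exists x; split=> //; exists i.
Qed.

End Scott.

Arguments fin_upsets {d} P.

(* Type alias of P carrying the Scott topology, i.e. the space Sigma P *)
Definition scott {d : Order.disp_t} (P : porderType d) : Type := P.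

HB.instance Definition _ d (P : porderType d) := Choice.on (scott P).

HB.instance Definition _ d (P : porderType d) :=
  @isOpenTopological.Build (scott P) (@scott_open d P)
    scott_openT scott_openI scott_open_bigU.

Definition property_R {d : Order.disp_t} (P : porderType d) : Prop :=
  forall (I : Type) (G : I -> set P) (U : set P),
    [set: I] !=set0 -> (forall i, fin_upsets P (G i)) -> scott_open U ->
    \bigcap_i G i `<=` U ->
    exists I0 : set I,
      [/\ I0 !=set0, finite_set I0 & \bigcap_(i in I0) G i `<=` U].

(* P *p P is P * P with the coordinatewise order; scott P * scott P carries
   the product topology. Both types unfold to P * P. *)
Definition scott_prod_eq {d : Order.disp_t} (P : porderType d) : Prop :=
  (@open (scott (P *p P)) : set (set (P * P))) = @open (scott P * scott P)%type.

Definition irreducible_set {T : topologicalType} (A : set T) : Prop :=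
  A !=set0 /\
  forall F1 F2 : set T, closed F1 -> closed F2 ->
    A `<=` F1 `|` F2 -> A `<=` F1 \/ A `<=` F2.

Definition sober (T : topologicalType) : Prop :=
  forall A : set T, closed A -> irreducible_set A ->
    exists! x : T, A = closure [set x].

(* Main.v *)
Require Import Defs.
From mathcomp Require Import all_boot all_order.
From mathcomp Require Import classical_sets topology.
From mathcomp Require Import boolp cardinality.

(** Property R applied to principal upper sets is a compactness statement
    about upper bounds: if all upper bounds of a directed set lie in a Scott
    open set [U], then so does the principal upper set of one of its members
    ([property_R_directed]).

    Two consequences carry the proof.
    - [P] is directed complete ([property_R_sup]). Were the upper bounds of a
      directed set [D] all outside the Scott closure of [D], compactness would
      put some member of [D] outside that closure. So some upper bound lies in
      the closure, and since every other upper bound [c] satisfies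
      closure D `<=` down-set of c, it is the least one.
    - For Scott open [U], the set W of pairs (x, y) all of whose common upper
      bounds lie in [U] is Scott open in the product order
      ([common_ub_open]). It stands in for the preimage of [U] under a binary
      join, which need not exist.

    Let [A] be closed and irreducible, and let x, y in [A] have no common upper
    bound in [A]. The set W, for [U] the complement of [A], contains (x, y) and
    is open in the product topology, so it contains a box V1 x V2 around
    (x, y). By irreducibility some z in [A] is in both V1 and V2; then W
    contains (z, z), and z, being a bound of itself, is outside [A]: a
    contradiction ([irreducible_directed]). Hence [A] is directed, its
    supremum s exists and belongs to the closed set [A], and [A] is the
    down-set of s, that is the closure of s. *)

Set Implicit Arguments.
Unset Strict Implicit.
Unset Printing Implicit Defensive.

Import Order.TTheory.

Local Open Scope classical_set_scope.

(** * Scott open sets and directed sets *)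

Section ScottBasics.
Context {d : Order.disp_t} {P : porderType d}.
Implicit Types (A D U : set P) (x y z s : P).

Lemma scott_open_up U x y : scott_open U -> U x -> (x <= y)%O -> U y.
Proof. by move=> Uop Ux xy; rewrite Uop.1; exists x. Qed.

Lemma open_scottE : (@open (scott P) : set (set P)) = @scott_open d P.
Proof. by []. Qed.

Lemma fin_upsets_principal x : fin_upsets P [set z | (x <= z)%O].
Proof.
exists [set x]; first by split; [exists x | exact: finite_set1].
by apply/seteqP; split=> z; [case=> a -> | exists x].
Qed.

Lemma closed_downset x : closed ([set z | (z <= x)%O] : set (scott P)).
Proof.
rewrite -openC open_scottE; split=> [|D s _ [_ slub] nsx].
  apply/seteqP; split=> [|y [z nzx zy]]; first exact: up_closure_sub.
  by move=> yx; apply: nzx; apply: le_trans yx.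
apply/set0P/eqP => DU0; apply: nsx; apply: slub => y Dy.
apply: contrapT => nyx.
by have : (D `&` ~` [set z | (z <= x)%O]) y by []; rewrite DU0.
Qed.

Lemma closed_down_closed A x y :
  closed (A : set (scott P)) -> A y -> (x <= y)%O -> A x.
Proof.
rewrite -openC => Aop Ay xy; apply: contrapT => nAx.
exact: (scott_open_up Aop nAx xy).
Qed.

Lemma closure_point x : closure ([set x] : set (scott P)) = [set z | (z <= x)%O].
Proof.
rewrite closureE; apply/seteqP; split=> z.
  by apply: smallest_sub; [exact: closed_downset | move=> _ -> /=].
move=> /= zx B [Bcl xB]; exact: (closed_down_closed Bcl (xB x erefl) zx).
Qed.

Lemma directed_finite_ub D (F : set P) :
  directed D -> finite_set F -> F `<=` D ->
  exists2 z, D z & forall x, F x -> (x <= z)%O.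
Proof.
move=> [[z0 Dz0] Ddir] /finite_seqP[s ->].
elim: s => [|a s IHs] sD; first by exists z0.
have [x xs|z Dz zub] := IHs; first by apply: sD; rewrite /= inE xs orbT.
have [|w Dw /andP[aw zw]] := Ddir a z _ Dz.
  by apply: sD; rewrite /= inE eqxx.
exists w => // x /=; rewrite inE => /orP[/eqP -> //|xs].
exact: le_trans (zub _ xs) zw.
Qed.

End ScottBasics.

(** * Consequences of property R *)

(** A monotone family [f j] of maps turns the directed set [D] into a filtered
    family of sets of upper bounds; a finite subfamily involves finitely many
    members of [D], which one member of [D] dominates. The index [j] makes the
    lemma cover both [P] itself (one map, the identity) and the product order
    (the two projections). *)
Lemma property_R_directed d (P : porderType d) d' (Q : porderType d')
    (J : Type) (f : J -> Q -> P) (D : set Q) (U : set P) :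
  property_R P -> [set: J] !=set0 ->
  (forall j, {homo f j : p q / (p <= q)%O}) ->
  directed D -> scott_open U ->
  (forall z, (forall j q, D q -> (f j q <= z)%O) -> U z) ->
  exists2 q, D q & forall z, (forall j, (f j q <= z)%O) -> U z.
Proof.
move=> RP [j0 _] fmono Ddir Uop ubU.
pose G (i : J * {q | D q}) := [set z | (f i.1 (sval i.2) <= z)%O].
have [q0 Dq0] := Ddir.1.
have [||z Gz|I0 [_ I0fin I0U]] := RP _ G U _ _ Uop.
- by exists (j0, exist _ q0 Dq0).
- by move=> i; exact: fin_upsets_principal.
- by apply: ubU => j q Dq; exact: (Gz (j, exist _ q Dq)).
have [|q Dq qub] := directed_finite_ub Ddir
    (finite_image (fun i => sval i.2) I0fin).
  by move=> _ [[j [q Dq]] _ <-].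
exists q => // z zub; apply: I0U => i I0i.
apply: le_trans (zub i.1); apply: fmono; apply: qub.
by exists i.
Qed.

(** The least upper bound is found inside the Scott closure of [D], because
    the closure lies below every upper bound of [D]. *)
Lemma property_R_sup d (P : porderType d) (D : set P) :
  property_R P -> directed D -> exists s, isLub D s.
Proof.
move=> RP Ddir; pose C : set (scott P) := closure (D : set (scott P)).
have Cop : scott_open (~` C : set P).
  by rewrite -open_scottE; apply: closed_openC; exact: closed_closure.
have [[b bub Cb]|noub] := pselect (exists2 b, ubound D b & C b).
  exists b; split=> // c cub.
  move: Cb; rewrite /C closureE.
  exact: (smallest_sub (@closed_downset _ _ c) cub).
have [||z zub|q Dq qU] := @property_R_directed _ P _ P unit (fun=> id) D
    (~` C) RP _ _ Ddir Cop.
- by exists tt.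
- by move=> _ p q.
- by move=> Cz; apply: noub; exists z => // q; exact: zub tt q.
by case: (qU q (fun=> lexx q) (subset_closure Dq)).
Qed.

Lemma common_ub_open d (P : porderType d) (U : set P) :
  property_R P -> scott_open U ->
  scott_open ([set p | forall z, (p.1 <= z)%O -> (p.2 <= z)%O -> U z]
              : set (P *p P)).
Proof.
move=> RP Uop; split=> [|D s Ddir [_ slub] sU].
  apply/seteqP; split=> [|p [q qU /andP[qp1 qp2]] z p1z p2z].
    exact: up_closure_sub.
  by apply: qU; [exact: le_trans p1z | exact: le_trans p2z].
have [||z zub|q Dq qU] := @property_R_directed _ P _ (P *p P) bool
    (fun j p => if j then p.1 else p.2) D U RP _ _ Ddir Uop.
- by exists true.
- by case=> p q /andP[].
- (* A bound of all coordinates of [D] is an upper bound (z, z) of [D]. *)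
  have /andP[s1z s2z] : (s <= ((z, z) : P *p P))%O.
    apply: slub => p Dp; apply/andP; split.
      exact: (zub true p Dp).
    exact: (zub false p Dp).
  exact: sU.
by exists q; split=> // z q1z q2z; apply: qU => -[].
Qed.

(** * Sobriety *)

Lemma irreducible_meet (T : topologicalType) (A V W : set T) :
  irreducible_set A -> open V -> open W ->
  A `&` V !=set0 -> A `&` W !=set0 -> A `&` (V `&` W) !=set0.
Proof.
move=> [_ Airr] Vop Wop [x [Ax Vx]] [y [Ay Wy]].
apply: contrapT => noz.
have [z Az|AV|AW] := Airr _ _ (open_closedC Vop) (open_closedC Wop).
- have [Vz|] := pselect (V z); last by left.
  by right=> Wz; apply: noz; exists z.
- exact: AV Ax Vx.
- exact: AW Ay Wy.
Qed.

(** The hypothesis on the product topology is what turns the Scott open set of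
    pairs [W] into a box, to which irreducibility applies. *)
Lemma irreducible_directed d (P : porderType d) (A : set (scott P)) :
  property_R P -> scott_prod_eq P -> closed A -> irreducible_set A ->
  directed (A : set P).
Proof.
move=> RP prodE Acl Airr; split=> [|x y Ax Ay]; first exact: Airr.1.
apply: contrapT => noub.
have Uop : scott_open (~` A : set P).
  by rewrite -open_scottE; exact: closed_openC.
pose W : set (P * P) :=
  [set p | forall z, (p.1 <= z)%O -> (p.2 <= z)%O -> (~` A) z].
have Wop : @open (scott P * scott P)%type W.
  by rewrite -prodE; exact: common_ub_open.
have Wxy : W (x, y).
  by move=> z xz yz Az; apply: noub; exists z => //; rewrite xz yz.
have [[V1 V2] [/= nV1 nV2] V12W] :
    nbhs ((x, y) : scott P * scott P) W by exact: open_nbhs_nbhs.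
move: nV1 nV2; rewrite !nbhsE => -[O1 [O1op O1x] O1V] [O2 [O2op O2y] O2V].
have [||z [Az [O1z O2z]]] := irreducible_meet Airr O1op O2op.
- by exists x.
- by exists y.
exact: (V12W (z, z) (conj (O1V _ O1z) (O2V _ O2z)) z (lexx z) (lexx z) Az).
Qed.

Theorem theorem5p15 (d : Order.disp_t) (P : porderType d) :
  property_R P -> scott_prod_eq P -> sober (scott P).
Proof.
move=> RP prodE A Acl Airr.
have Adir := irreducible_directed RP prodE Acl Airr.
have [s slub] := property_R_sup RP Adir.
have As : A s.
  apply: contrapT => nAs.
  have Uop : scott_open (~` A : set P).
    by rewrite -open_scottE; exact: closed_openC.
  by have [x [Ax nAx]] := Uop.2 _ _ Adir slub nAs.
have AE : A = closure ([set s] : set (scott P)).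
  rewrite closure_point; apply/seteqP; split=> x.
    exact: slub.1.
  exact: closed_down_closed.
exists s; split=> // t; rewrite AE !closure_point => stE.
apply/le_anti/andP; split.
  suff : [set z : P | (z <= t)%O] s by [].
  by rewrite -stE /=.
suff : [set z : P | (z <= s)%O] t by [].
by rewrite stE /=.
Qed.
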